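(* Let $N$ be a nonnegative integer. An alternating step function $\psi$ of order $N$ is uniquely determined by its Fourier coefficients $\hat\psi(0),\hat\psi(1),\dots,\hat\psi(N)$: if $\psi$ and $\varphi$ are alternating step functions of order $N$ with $\hat\psi(n)=\hat\varphi(n)$ for $n=0,\dots,N$, then $\hat\psi(n)=\hat\varphi(n)$ for all $n$, i.e. $\psi=\varphi$ a.e.
   Context: $\mathbb{T}$ is the unit circle with normalized Lebesgue measure; $\hat f(n)=\frac{1}{2\pi}\int_0^{2\pi} f(e^{i\theta})e^{-in\theta}\,d\theta$. For $c>0$ and $N$ a positive integer, an alternating step function of height $c$ and order $N$ is a real function in $L^\infty(\mathbb{T})$ that assumes (a.e.) alternately the values $c$ and $-c$ on $2N$ (nondegenerate) subarcs forming a partition of $\mathbb{T}$; an alternating step function of order $0$ is a constant function. The heights of $\psi$ and $\varphi$ are not assumed known or equal. *)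

(* Defs.v *)
From mathcomp Require Import all_boot all_order all_algebra.
From mathcomp Require Import all_classical all_reals all_analysis.
Set Implicit Arguments. Unset Strict Implicit. Unset Printing Implicit Defensive.
Import Order.TTheory GRing.Theory Num.Theory.
Import numFieldNormedType.Exports.
Local Open Scope classical_set_scope.
Local Open Scope ring_scope.

(* A function on the unit circle T is represented by the 2*pi-periodic
   function theta |-> f(e^{i theta}) on R; normalized Lebesgue measure on T
   corresponds to (1/(2 pi)) * Lebesgue measure on [0, 2 pi]. *)

Definition fourier_re (R : realType) (f : R -> R) (n : int) : R :=
  (2 * pi)^-1 * Rintegral (@lebesgue_measure R) `[0, 2 * pi]
     (fun x => f x * cos (n%:~R * x)).

Definition fourier_im (R : realType) (f : R -> R) (n : int) : R :=
  - ((2 * pi)^-1 * Rintegral (@lebesgue_measure R) `[0, 2 * pi]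
     (fun x => f x * sin (n%:~R * x))).

Definition fourier_coef (R : realType) (f : R -> R) (n : int) : R * R :=
  (fourier_re f n, fourier_im f n).

Definition alt_step (R : realType) (c : R) (N : nat) (f : R -> R) : Prop :=
  (forall x, f (x + 2 * pi) = f x) /\ measurable_fun setT f /\
  match N with
  | 0%N => exists a : R, {ae @lebesgue_measure R, forall x, f x = a}
  | _ => 0 < c /\ exists (t : nat -> R) (b : bool),
      (forall k, (k < 2 * N)%N -> t k < t k.+1) /\
      t (2 * N)%N = t 0%N + 2 * pi /\
      forall k, (k < 2 * N)%N ->
        {ae @lebesgue_measure R, forall x,
           x \in `]t k, t k.+1[ -> f x = (-1) ^+ (k + b) * c}
  end.

(* Main.v *)
(* Say c1 >= c2.  Half-angle sines vanishing at the 2N breakpoints of psi multiply to a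
   trigonometric polynomial of degree N which, up to a global sign, has the sign of psi almost
   everywhere; call it T.  Since |phi| = c2 <= c1 = |psi|, also psi - phi never has the sign
   opposite to psi, so (psi - phi) T >= 0.  The hypothesis makes psi - phi orthogonal to T, hence
   (psi - phi) T = 0, and psi = phi, almost everywhere.  For N = 0 take T = 1. *)
From HB Require Import structures.
Require Import Defs.
From mathcomp Require Import all_boot all_order all_algebra.
From mathcomp Require Import all_classical all_reals all_analysis.
From mathcomp Require Import measurable_realfun ring lra zify.
Import Order.TTheory GRing.Theory Num.Theory.
Import numFieldNormedType.Exports.
Local Open Scope classical_set_scope.
Local Open Scope ring_scope.

(** * Translation invariance and almost-everywhere statements for periodic predicates *)

Lemma lebesgue_measure_shift (R : realType) (a : R) (A : set R) :
  measurable A ->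
  pushforward (@lebesgue_measure R)
    (fun x : measurableTypeR R => x + a : measurableTypeR R) A = lebesgue_measure A.
Proof.
have ms : measurable_fun [set: measurableTypeR R]
    (fun x : measurableTypeR R => x + a : measurableTypeR R).
  exact: measurable_funD.
move=> mA; apply/esym.
pose f : {mfun (measurableTypeR R) >-> (measurableTypeR R)} :=
  HB.pack (fun x => x + a) (isMeasurableFun.Build _ _ _ _ _ ms).
(* Lebesgue measure is determined by its values on half-open intervals, and a translate of such an
   interval keeps its length. *)
apply: (@lebesgue_measure_unique R
  (pushforward (@lebesgue_measure R) f)) => // _ [[u v]] _ <-.
rewrite /pushforward.
rewrite [X in _ = lebesgue_measure X](_ : _ = [set` `]u - a, v - a]]); last first.
  by apply/seteqP; split=> x /=; rewrite !in_itv /=; lra.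
rewrite !lebesgue_measure_itv/= !lte_fin ltrD2r.
by case: ifP => // _; rewrite -!EFinD; congr EFin; lra.
Qed.

Lemma ae_shift (R : realType) (a : R) (P : R -> Prop) :
  {ae @lebesgue_measure R, forall x, P x} ->
  {ae @lebesgue_measure R, forall x, P (x + a)}.
Proof.
case=> A [mA A0 PA].
exists ((fun x => x + a) @^-1` A); split.
- rewrite -[X in measurable X]setTI.
  exact: (@measurable_funD _ _ _ _ id (cst a)).
- by have := lebesgue_measure_shift R a A mA; rewrite A0.
- by move=> x Px; exact: (PA (x + a)).
Qed.

(** The translates of one period by integer multiples of [p] tile the line, and countably many null
    sets have a null union. *)
Lemma ae_periodic (R : realType) (p a : R) (P : R -> Prop) :
  0 < p -> (forall x, P (x + p) <-> P x) ->
  {ae @lebesgue_measure R, forall x, a <= x < a + p -> P x} ->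
  {ae @lebesgue_measure R, forall x, P x}.
Proof.
move=> p0 Pp aeP.
have Pn n x : P (x + p *+ n) <-> P x.
  elim: n x => [|n IH] x; first by rewrite mulr0n addr0.
  by rewrite mulrS addrA IH Pp.
have H1 := ae_foralln (fun n => ae_shift R (p *+ n) _ aeP).
have H2 := ae_foralln (fun n => ae_shift R (- (p *+ n)) _ aeP).
move: H1 H2; apply: filterS2 => x H1 H2.
(* [m] counts the periods between [a] and [x]. If [m = n >= 0], [x] is moved back by [n] periods;
   [Negz n] means [-(n + 1)], hence [n.+1] periods forward. *)
pose m := Num.floor ((x - a) / p).
have /andP[lm um] := floor_itv ((x - a) / p).
rewrite -/m ler_pdivlMr // in lm.
rewrite -/m ltr_pdivrMr // intrD in um.
have : m%:~R * p <= x - a < (m%:~R + 1) * p by apply/andP.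
clearbody m; case: m {lm um} => n; rewrite ?NegzE ?mulrNz -pmulrn.
  move=> h; have := Pn n (x - p *+ n); rewrite subrK => ->; apply: H2; rewrite -mulr_natl; lra.
move=> h; rewrite -(Pn n.+1); apply: H1; rewrite -mulr_natl; lra.
Qed.

(** * Trigonometric polynomials and the sign of a product of half-angle sines *)

(** The span is given by generators rather than by coefficients, so that linear facts follow by
    induction on its construction. Constants come from [cos] with [k = 0]. *)
Inductive trig_poly (R : realType) (N : nat) : (R -> R) -> Prop :=
| trig_poly_cos k : (k <= N)%N -> trig_poly R N (fun x => cos (k%:R * x))
| trig_poly_sin k : (k <= N)%N -> trig_poly R N (fun x => sin (k%:R * x))
| trig_polyD f g : trig_poly R N f -> trig_poly R N g ->
    trig_poly R N (fun x => f x + g x)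
| trig_polyZ a f : trig_poly R N f -> trig_poly R N (fun x => a * f x).

Lemma trig_polyS (R : realType) (N : nat) (f : R -> R) :
  trig_poly R N f -> trig_poly R N.+1 f.
Proof.
elim=> [k kN|k kN|g h _ tg _ th|a g _ tg].
- by apply: trig_poly_cos; exact: leqW.
- by apply: trig_poly_sin; exact: leqW.
- exact: trig_polyD.
- exact: trig_polyZ.
Qed.

(** Product-to-sum formulas replace frequency [k] by [k + 1] and [k - 1]. The case [k = 0] is
    separate because frequencies are natural numbers. *)
Lemma trig_polyMcos (R : realType) (N : nat) (f : R -> R) :
  trig_poly R N f -> trig_poly R N.+1 (fun x => f x * cos x).
Proof.
elim=> [k kN|k kN|g h _ tg _ th|a g _ tg].
- case: k kN => [_|k kN].
    rewrite (_ : (fun _ => _) = (fun x => cos (1%:R * x))); first exact: trig_poly_cos.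
    by apply/funext => x; rewrite mul0r cos0 !mul1r.
  rewrite (_ : (fun _ => _) = (fun x => 2^-1 * (cos (k.+2%:R * x) + cos (k%:R * x)))).
    by apply: trig_polyZ; apply: trig_polyD; apply: trig_poly_cos; lia.
  apply/funext => x; rewrite (_ : k.+2%:R * x = k.+1%:R * x + x); last first.
    by rewrite -(natr1 k.+1); ring.
  rewrite (_ : k%:R * x = k.+1%:R * x - x); last by rewrite -(natr1 k); ring.
  by rewrite cosB cosD; field.
- case: k kN => [_|k kN].
    rewrite (_ : (fun _ => _) = (fun x => sin (0%:R * x))); first exact: trig_poly_sin.
    by apply/funext => x; rewrite mul0r sin0 !mul0r.
  rewrite (_ : (fun _ => _) = (fun x => 2^-1 * (sin (k.+2%:R * x) + sin (k%:R * x)))).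
    by apply: trig_polyZ; apply: trig_polyD; apply: trig_poly_sin; lia.
  apply/funext => x; rewrite (_ : k.+2%:R * x = k.+1%:R * x + x); last first.
    by rewrite -(natr1 k.+1); ring.
  rewrite (_ : k%:R * x = k.+1%:R * x - x); last by rewrite -(natr1 k); ring.
  by rewrite sinB sinD; field.
- by under eq_fun do rewrite mulrDl; exact: trig_polyD.
- by under eq_fun do rewrite -mulrA; exact: trig_polyZ.
Qed.

Lemma trig_polyMsin (R : realType) (N : nat) (f : R -> R) :
  trig_poly R N f -> trig_poly R N.+1 (fun x => f x * sin x).
Proof.
elim=> [k kN|k kN|g h _ tg _ th|a g _ tg].
- case: k kN => [_|k kN].
    rewrite (_ : (fun _ => _) = (fun x => sin (1%:R * x))); first exact: trig_poly_sin.
    by apply/funext => x; rewrite mul0r cos0 !mul1r.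
  rewrite (_ : (fun _ => _) = (fun x => 2^-1 * (sin (k.+2%:R * x) + (-1) * sin (k%:R * x)))).
    by apply: trig_polyZ; apply: trig_polyD; last apply: trig_polyZ; apply: trig_poly_sin; lia.
  apply/funext => x; rewrite (_ : k.+2%:R * x = k.+1%:R * x + x); last first.
    by rewrite -(natr1 k.+1); ring.
  rewrite (_ : k%:R * x = k.+1%:R * x - x); last by rewrite -(natr1 k); ring.
  by rewrite sinB sinD; field.
- case: k kN => [_|k kN].
    rewrite (_ : (fun _ => _) = (fun x => sin (0%:R * x))); first exact: trig_poly_sin.
    by apply/funext => x; rewrite mul0r sin0 !mul0r.
  rewrite (_ : (fun _ => _) = (fun x => 2^-1 * (cos (k%:R * x) + (-1) * cos (k.+2%:R * x)))).
    by apply: trig_polyZ; apply: trig_polyD; last apply: trig_polyZ; apply: trig_poly_cos; lia.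
  apply/funext => x; rewrite (_ : k.+2%:R * x = k.+1%:R * x + x); last first.
    by rewrite -(natr1 k.+1); ring.
  rewrite (_ : k%:R * x = k.+1%:R * x - x); last by rewrite -(natr1 k); ring.
  by rewrite cosB cosD; field.
- by under eq_fun do rewrite mulrDl; exact: trig_polyD.
- by under eq_fun do rewrite -mulrA; exact: trig_polyZ.
Qed.

(* Two half-angle sines multiply to a trigonometric polynomial of degree one. *)
Lemma trig_poly_prod_sin (R : realType) (t : nat -> R) (N : nat) :
  trig_poly R N (fun x => \prod_(k < 2 * N) sin ((x - t k) / 2)).
Proof.
elim: N => [|N IH].
  rewrite (_ : (fun _ => _) = (fun x => cos (0%:R * x))); first exact: trig_poly_cos.
  by apply/funext => x; rewrite big_ord0 mul0r cos0.
pose a := t (2 * N)%N; pose b := t (2 * N).+1; pose P x := \prod_(k < 2 * N) sin ((x - t k) / 2).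
(* The two new factors multiply to half of [cos ((b - a) / 2) - cos (x - (a + b) / 2)]; the second
   cosine is expanded by the subtraction formula. *)
rewrite (_ : (fun _ => _) = (fun x => 2^-1 * (cos ((b - a) / 2) * P x
    + ((- cos ((a + b) / 2)) * (P x * cos x) + (- sin ((a + b) / 2)) * (P x * sin x)))));
  last first.
  apply/funext => x; rewrite mulnS !big_ord_recr /= -/(P x) -/a -/b.
  have -> : (x - a) / 2 = (x - (a + b) / 2 + (b - a) / 2) / 2 by field.
  have -> : (x - b) / 2 = (x - (a + b) / 2 - (b - a) / 2) / 2 by field.
  have E u v : sin ((u + v) / 2) * sin ((u - v) / 2) = 2^-1 * (cos v - cos u).
    have -> : cos v = cos ((u + v) / 2 - (u - v) / 2) by congr cos; field.
    have -> : cos u = cos ((u + v) / 2 + (u - v) / 2) by congr cos; field.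
    by rewrite cosB cosD; field.
  by rewrite -mulrA E cosB; ring.
apply: trig_polyZ; apply: trig_polyD; last apply: trig_polyD; apply: trig_polyZ.
- exact: trig_polyS.
- exact: trig_polyMcos.
- exact: trig_polyMsin.
Qed.

Lemma trig_poly_periodic (R : realType) (N : nat) (f : R -> R) :
  trig_poly R N f -> forall x, f (x + 2 * pi) = f x.
Proof.
have E (k : nat) (x : R) : k%:R * (x + 2 * pi) = k%:R * x + (pi *+ 2) *+ k.
  by rewrite mulrDr -(mulr_natl (pi *+ 2) k) -(mulr_natl pi 2).
elim=> [k _|k _|g h _ tg _ th|a g _ tg] x; rewrite ?tg ?th // E.
  exact/periodicn/cosD2pi.
exact/periodicn/sinD2pi.
Qed.

(** All breakpoints lie within one period, so each [(x - t j) / 2] is in []-pi, pi[] and its sine is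
    positive exactly when [j <= k]. The other [2 * N - k.+1] factors are negative, a number with the
    parity of [k.+1]. *)
Lemma alternating_sign_prod_sin (R : realType) (N : nat) (t : nat -> R) (k : nat) (x : R) :
  (forall k, (k < 2 * N)%N -> t k < t k.+1) -> t (2 * N)%N = t 0%N + 2 * pi ->
  (k < 2 * N)%N -> t k < x < t k.+1 ->
  0 < (-1) ^+ k.+1 * \prod_(j < 2 * N) sin ((x - t j) / 2).
Proof.
move=> tlt tper kN /andP[tkx xtk].
have tle i j : (i <= j <= 2 * N)%N -> t i <= t j.
  move=> /andP[]; elim: j => [|j IH]; first by rewrite leqn0 => /eqP ->.
  rewrite leq_eqVlt => /predU1P[-> //|ij jN].
  by apply: le_trans (IH ij (ltnW jN)) _; exact/ltW/tlt.
have x0 : t 0%N <= t k by apply: tle; lia.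
have x1 : t k.+1 <= t (2 * N)%N by apply: tle; lia.
(* The global sign is spread over the factors, [-1] for each [j <= k]. A further [-1] per factor,
   harmless since their number is even, then makes every factor positive. *)
have sgn n : \prod_(j < n) (if (j <= k)%N then -1 else 1) = (-1) ^+ minn n k.+1 :> R.
  elim: n => [|n IH]; first by rewrite big_ord0 min0n.
  rewrite big_ord_recr IH /=; case: leqP => nk.
    by rewrite (_ : minn n.+1 k.+1 = (minn n k.+1).+1) ?exprSr //; lia.
  by rewrite mulr1; congr (_ ^+ _); lia.
rewrite -(_ : minn (2 * N) k.+1 = k.+1); last by lia.
rewrite -sgn -big_split /=.
have sgn1 : 1 = \prod_(j < 2 * N) -1 :> R.
  by rewrite prodr_const card_ord exprM sqrrN !expr1n.
rewrite -[ltRHS]mul1r [X in X * _]sgn1.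
rewrite -big_split /=; apply: prodr_gt0 => j _.
have jN := ltn_ord j; have pi0 := pi_gt0 R.
have t0j : t 0%N <= t j by apply: tle; lia.
have tjN : t j <= t (2 * N)%N by apply: tle; lia.
case: leqP => jk.
  have tjk : t j <= t k by apply: tle; lia.
  by rewrite !mulN1r opprK sin_gt0_pi //; lra.
have tjk : t k.+1 <= t j by apply: tle; lia.
by rewrite mul1r mulN1r -sinN sin_gt0_pi //; lra.
Qed.

(** * Integrals over one period and orthogonality to trigonometric polynomials *)

#[local] Instance lebesgue_ae_filter (R : realType) :
  Filter (nbhs (almost_everywhere (@lebesgue_measure R))).
Proof. exact: ae_filter_ringOfSetsType. Qed.

Lemma integrable_ae_bounded (R : realType) (D : set R) (M : R) (f : R -> R) :
  measurable D -> (@lebesgue_measure R D < +oo)%E -> measurable_fun setT f ->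
  {ae @lebesgue_measure R, forall x, `|f x| <= M} ->
  (@lebesgue_measure R).-integrable D (EFin \o f).
Proof.
move=> mD Doo mf fM.
have mfD : measurable_fun D f by exact: measurable_funTS.
apply/integrableP; split; first exact/measurable_EFinP.
have : (\int[lebesgue_measure]_(x in D) `|(EFin \o f) x| <= `|M|%:E * lebesgue_measure D)%E.
  apply: integral_le_bound => //; first exact/measurable_EFinP.
  apply: filterS fM => x fM _.
  by rewrite lee_fin (le_trans fM) // ler_norm.
move=> /le_lt_trans; apply.
by rewrite lte_mul_pinfty.
Qed.

Lemma Rintegral_ge0_eq0 (R : realType) (D : set R) (f : R -> R) :
  measurable D -> (@lebesgue_measure R).-integrable D (EFin \o f) ->
  {ae @lebesgue_measure R, forall x, 0 <= f x} ->
  Rintegral (@lebesgue_measure R) D f = 0 ->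
  {ae @lebesgue_measure R, forall x, D x -> f x = 0}.
Proof.
move=> mD fint f0 int0.
have mf := measurable_int _ fint.
have : ae_eq (@lebesgue_measure R) D (EFin \o f) (cst 0%E).
apply/(@ae_eq_integral_abs _ _ _ (@lebesgue_measure R) D mD (EFin \o f) mf).
  rewrite (@ae_eq_integral _ _ _ (@lebesgue_measure R) D (EFin \o f)) //; last 2 first.
  - exact: measurableT_comp.
  - by apply: filterS f0 => x f0 _ /=; rewrite ger0_norm.
  (* [Rintegral] applies [fine], which sends infinite values to 0; integrability rules these out, so
     the extended integral itself is 0. *)
  by rewrite -[LHS]fineK ?integrable_fin_num // -/(Rintegral _ _ _) int0.
by apply: filterS => x /[apply] /= -[].
Qed.

Lemma fourier_coef_ae (R : realType) (f g : R -> R) (n : int) :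
  measurable_fun setT f -> measurable_fun setT g ->
  {ae @lebesgue_measure R, forall x, f x = g x} ->
  fourier_coef f n = fourier_coef g n.
Proof.
move=> mf mg fg.
have E (h : R -> R) : continuous h ->
    Rintegral (@lebesgue_measure R) `[0, 2 * pi] (fun x => f x * h x) =
    Rintegral (@lebesgue_measure R) `[0, 2 * pi] (fun x => g x * h x).
  move=> /continuous_measurable_fun mh; congr fine.
  apply: ae_eq_integral => //.
  - by apply/measurable_EFinP/measurable_funTS; exact: measurable_funM.
  - by apply/measurable_EFinP/measurable_funTS; exact: measurable_funM.
  - by apply: filterS fg => x /= -> _.
have cZ : continuous (fun x : R => n%:~R * x).
  by move=> x; apply: cvgM; [exact: cvg_cst|exact: cvg_id].
rewrite /fourier_coef /fourier_re /fourier_im !E // => x.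
  by apply: continuous_comp; [exact: cZ|exact: continuous_sin].
by apply: continuous_comp; [exact: cZ|exact: continuous_cos].
Qed.

(** Real and imaginary parts of the coefficients give the cosine and sine generators; linearity
    gives the rest. Integrability is carried through the induction because additivity of the
    integral requires it. *)
Lemma trig_poly_orthogonal (R : realType) (N : nat) (M : R) (f g T : R -> R) :
  measurable_fun setT f -> measurable_fun setT g ->
  {ae @lebesgue_measure R, forall x, `|f x| <= M} ->
  {ae @lebesgue_measure R, forall x, `|g x| <= M} ->
  (forall n : nat, (n <= N)%N -> fourier_coef f n%:Z = fourier_coef g n%:Z) ->
  trig_poly R N T ->
  (@lebesgue_measure R).-integrable `[0, 2 * pi] (EFin \o (fun x => (f x - g x) * T x)) /\
  Rintegral (@lebesgue_measure R) `[0, 2 * pi] (fun x => (f x - g x) * T x) = 0.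
Proof.
move=> mf mg fM gM fg.
have mD : measurable (`[0, 2 * pi] : set (measurableTypeR R)) by exact: measurable_itv.
have Doo : (@lebesgue_measure R `[0%R, (2 * pi)%R] < +oo)%E.
  by rewrite lebesgue_measure_itv /=; case: ifP => // _; rewrite -EFinD ltry.
have pi2 : (2 * pi : R) != 0 by rewrite mulf_neq0 // gt_eqF // pi_gt0.
have intM (u h : R -> R) : measurable_fun setT u ->
    {ae @lebesgue_measure R, forall x, `|u x| <= M} ->
    continuous h -> (forall x, `|h x| <= 1) ->
    (@lebesgue_measure R).-integrable `[0, 2 * pi] (EFin \o (fun x => u x * h x)).
  move=> mu uM /continuous_measurable_fun mh h1.
  apply: (@integrable_ae_bounded _ _ M) => //; first exact: measurable_funM.
  apply: filterS uM => x uM; rewrite normrM (le_trans _ uM) //.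
  by rewrite ler_piMr.
have base (h : R -> R) : continuous h -> (forall x, `|h x| <= 1) ->
    Rintegral (@lebesgue_measure R) `[0, 2 * pi] (fun x => f x * h x) =
    Rintegral (@lebesgue_measure R) `[0, 2 * pi] (fun x => g x * h x) ->
    (@lebesgue_measure R).-integrable `[0, 2 * pi] (EFin \o (fun x => (f x - g x) * h x)) /\
    Rintegral (@lebesgue_measure R) `[0, 2 * pi] (fun x => (f x - g x) * h x) = 0.
  move=> ch h1 E.
  have fi := intM _ _ mf fM ch h1; have gi := intM _ _ mg gM ch h1.
  have -> : (fun x => (f x - g x) * h x) = (fun x => f x * h x - g x * h x).
    by apply/funext => x; rewrite mulrBl.
  split; last by rewrite RintegralB // E subrr.
  exact: (integrableB mD fi gi).
have cZ k : continuous (fun x : R => k%:R * x).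
  by move=> x; apply: cvgM; [exact: cvg_cst|exact: cvg_id].
elim=> [k kN|k kN|u v _ [ui u0] _ [vi v0]|a u _ [ui u0]].
- apply: base => [x|x|]; last 2 first.
  + exact: cos_max.
  (* The first component of the coefficient pair is the cosine integral, up to the nonzero factor
     [(2 * pi)^-1]. *)
  + by have [/(mulfI (invr_neq0 pi2))] := fg k kN.
  by apply: continuous_comp; [exact: cZ|exact: continuous_cos].
- apply: base => [x|x|]; last 2 first.
  + exact: sin_max.
  + by have [_ /oppr_inj/(mulfI (invr_neq0 pi2))] := fg k kN.
  by apply: continuous_comp; [exact: cZ|exact: continuous_sin].
- have -> : (fun x => (f x - g x) * (u x + v x)) =
      (fun x => (f x - g x) * u x + (f x - g x) * v x).
    by apply/funext => x; rewrite mulrDr.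
  split; last by rewrite RintegralD // u0 v0 addr0.
  exact: (integrableD mD ui vi).
- have -> : (fun x => (f x - g x) * (a * u x)) = (fun x => a * ((f x - g x) * u x)).
    by apply/funext => x; rewrite mulrCA.
  split; last by rewrite RintegralZl // u0 mulr0.
  exact: (integrableZl mD a ui).
Qed.

(** A nonnegative function with zero integral vanishes almost everywhere, and [T] can then be
    cancelled. This yields equality on [[0, 2 * pi]], which periodicity extends to the line. *)
Lemma ae_eq_of_trig_poly_sign (R : realType) (N : nat) (M : R) (f g T : R -> R) :
  (forall x, f (x + 2 * pi) = f x) -> (forall x, g (x + 2 * pi) = g x) ->
  measurable_fun setT f -> measurable_fun setT g ->
  {ae @lebesgue_measure R, forall x, `|f x| <= M} ->
  {ae @lebesgue_measure R, forall x, `|g x| <= M} ->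
  (forall n : nat, (n <= N)%N -> fourier_coef f n%:Z = fourier_coef g n%:Z) ->
  trig_poly R N T ->
  {ae @lebesgue_measure R, forall x, 0 <= (f x - g x) * T x /\ T x != 0} ->
  {ae @lebesgue_measure R, forall x, f x = g x}.
Proof.
move=> fp gp mf mg fM gM fg tT signT.
have [Ti T0] := trig_poly_orthogonal _ _ _ _ _ _ mf mg fM gM fg tT.
have mD : measurable (`[0, 2 * pi] : set (measurableTypeR R)) by exact: measurable_itv.
have ge0 : {ae @lebesgue_measure R, forall x, 0 <= (f x - g x) * T x}.
  by apply: filterS signT => x [].
have := Rintegral_ge0_eq0 _ _ _ mD Ti ge0 T0.
move=> eq0; apply: (ae_periodic _ (2 * pi) 0) => [|x|].
- by rewrite mulr_gt0 // pi_gt0.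
- by rewrite fp gp.
- move: eq0 signT; apply: filterS2 => x eq0 [_ Tx] xD.
  have /eqP : (f x - g x) * T x = 0.
    by apply: eq0; rewrite /= in_itv /=; move/andP: xD => [-> /ltW]; rewrite add0r.
  by rewrite mulf_eq0 (negbTE Tx) orbF subr_eq0 => /eqP.
Qed.

(** * Alternating step functions and their uniqueness *)

Lemma alt_step_trig_poly (R : realType) (c : R) (N : nat) (f : R -> R) :
  alt_step c N.+1 f -> exists2 T, trig_poly R N.+1 T &
    {ae @lebesgue_measure R, forall x, `|f x| = c /\ 0 < f x * T x}.
Proof.
move=> [fp [mf [c0 [t [b [tlt [tper ft]]]]]]].
(* On arc [k] the product has sign [(-1) ^+ k.+1] and [f] has sign [(-1) ^+ (k + b)]; the factor
   [(-1) ^+ b.+1] makes them agree. *)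
pose T x := (-1) ^+ b.+1 * \prod_(j < 2 * N.+1) sin ((x - t j) / 2).
have tT : trig_poly R N.+1 T by exact/trig_polyZ/trig_poly_prod_sin.
exists T => //.
have ft' : {ae @lebesgue_measure R, forall x, forall k, (k < 2 * N.+1)%N ->
    x \in `]t k, t k.+1[ -> f x = (-1) ^+ (k + b) * c}.
  apply: ae_foralln => k; case: (ltnP k (2 * N.+1)) => kN; last exact: aeW.
  by apply: filterS (ft k kN) => x fx _.
(* The arcs are open, so the countably many breakpoints are discarded as a null set. *)
have nt : {ae @lebesgue_measure R, forall x, forall k, x <> t k}.
  apply: ae_foralln => k; exists [set t k]; split => //.
  - exact: lebesgue_measure_set1.
  - by move=> x /= /contrapT.
apply: (ae_periodic _ (2 * pi) (t 0%N)) => [|x|].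
- by rewrite mulr_gt0 // pi_gt0.
- by rewrite fp (trig_poly_periodic _ _ _ tT).
rewrite -tper; move: ft' nt; apply: filterS2 => x ft' nt.
have ex n : t 0%N <= x < t n -> exists2 k, (k < n)%N & t k < x < t k.+1.
  elim: n => [|n IH]; first by move=> /andP[/le_lt_trans/[apply]]; rewrite ltxx.
  move=> /andP[x0 xn]; case: (ltP x (t n)) => [xtn|tnx].
    by have [|k kn tk] := IH; [rewrite x0|exists k => //; exact: leqW].
  exists n => //; rewrite xn andbT lt_neqAle tnx andbT.
  by apply/eqP => /esym; exact: nt.
move=> /ex[k kN tk]; have -> : f x = (-1) ^+ (k + b) * c.
  by apply: ft' => //; rewrite in_itv.
rewrite normrM normrX normrN1 expr1n mul1r gtr0_norm //; split => //.
rewrite mulrAC pmulr_lgt0 // /T mulrA -exprD.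
have := alternating_sign_prod_sin _ _ _ _ _ tlt tper kN tk.
rewrite (_ : (k + b + b.+1 = k.+1 + 2 * b)%N); last by rewrite mul2n addnS -addnA addnn addSn.
by rewrite exprD exprM sqrrN !expr1n mulr1.
Qed.

Lemma alt_step_ae_eq (R : realType) (N : nat) (c1 c2 : R) (f g : R -> R) :
  alt_step c1 N f -> alt_step c2 N g ->
  (forall n : nat, (n <= N)%N -> fourier_coef f n%:Z = fourier_coef g n%:Z) ->
  {ae @lebesgue_measure R, forall x, f x = g x}.
Proof.
case: N => [|N].
  move=> [fp [mf [a fa]]] [gp [mg [b gb]]].
  (* With [b <= a] the difference is almost everywhere the constant [a - b >= 0], so the constant 1,
     written [cos (0%:R * x)], serves as [T]. *)
  wlog ba : f g a b fp mf fa gp mg gb / b <= a => [W fg|fg].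
    have [|/ltW] := leP b a; first by move=> ba; exact: (W f g a b).
    move=> ab; have := W g f b a gp mg gb fp mf fa ab (fun n nN => esym (fg n nN)).
    by apply: filterS => x ->.
  apply: (ae_eq_of_trig_poly_sign R 0 (Num.max `|a| `|b|) f g (fun x => cos (0%:R * x))) => //.
  - by apply: filterS fa => x ->; rewrite le_max lexx.
  - by apply: filterS gb => x ->; rewrite le_max lexx orbT.
  - exact: trig_poly_cos.
  - move: fa gb; apply: filterS2 => x -> ->.
    by rewrite mul0r cos0 mulr1 subr_ge0; split => //; exact: oner_neq0.
(* The hypotheses are symmetric, so [f] may be taken as the function of larger height; its
   breakpoints define [T]. *)
wlog c21 : f g c1 c2 / c2 <= c1 => [W fs gs fg|].
  have [|/ltW] := leP c2 c1; first by move=> c21; exact: (W f g c1 c2).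
  move=> c12; have := W g f c2 c1 c12 gs fs (fun n nN => esym (fg n nN)).
  by apply: filterS => x ->.
move=> fs gs fg; have [T tT fT] := alt_step_trig_poly _ _ _ _ fs.
have [S _ gT] := alt_step_trig_poly _ _ _ _ gs.
have [fp [mf _]] := fs; have [gp [mg _]] := gs.
apply: (ae_eq_of_trig_poly_sign R N.+1 c1 f g T) => //.
- by apply: filterS fT => x [->].
- by apply: filterS gT => x [->].
move: fT gT; apply: filterS2 => x [fc fT0] [gc _]; split; last first.
  by apply: contraTneq fT0 => ->; rewrite mulr0 ltxx.
(* Since [g x] lies between [- c2] and [c2], and [c2 <= c1], the difference is at least 0 where
   [f x = c1] and at most 0 where [f x = - c1]; [T x] has the sign of [f x]. *)
have := ler_norm (g x); have := ler_norm (- g x); rewrite normrN gc => g1 g2.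
have [f0|f0] := leP 0 (f x).
  have T0 : 0 <= T x by rewrite leNgt; apply: contraTN fT0 => /ltW T0; rewrite -leNgt mulr_ge0_le0.
  by rewrite ger0_norm // in fc; apply: mulr_ge0 => //; lra.
have T0 : T x <= 0 by rewrite leNgt; apply: contraTN fT0 => /ltW T0; rewrite -leNgt mulr_le0_ge0 // ltW.
by rewrite ltr0_norm // in fc; apply: mulr_le0 => //; lra.
Qed.

Theorem theorem5p2 (R : realType) (N : nat) (c1 c2 : R) (psi phi : R -> R) :
  alt_step c1 N psi -> alt_step c2 N phi ->
  (forall n : nat, (n <= N)%N -> fourier_coef psi n%:Z = fourier_coef phi n%:Z) ->
  (forall n : int, fourier_coef psi n = fourier_coef phi n) /\
  {ae @lebesgue_measure R, forall x, psi x = phi x}.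
Proof.
move=> psis phis E; have [_ [mpsi _]] := psis; have [_ [mphi _]] := phis.
have eq := alt_step_ae_eq _ _ _ _ _ _ psis phis E.
by split => // n; exact: fourier_coef_ae.
Qed.
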